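(* Let $\Gamma$ be a connected ve-srg, and let $G\le \mathrm{Aut}(\Gamma)$ be transitive on the vertices and on the edges of $\Gamma$. If $\Gamma$ is complete, then there is no normal subgroup $N$ of $G$ with $N\neq 1$ that is intransitive on $V(\Gamma)$. If $\Gamma$ is not complete, then for every normal subgroup $N\neq 1$ of $G$ that is intransitive on $V(\Gamma)$, the quotient graph $\Gamma_N$ is a connected ve-srg.
   Context: A strongly regular graph with parameters $(n,k,\lambda,\mu)$ is a (finite, simple) regular graph with $n$ vertices and valency $k$, such that each pair of adjacent vertices lies in exactly $\lambda$ triangles and each pair of distinct non-adjacent vertices (if such exist) is joined by exactly $\mu$ paths of length 2. The complete graph $K_n$ is regarded as strongly regular with parameters $(n,n-1,n-2,0)$. A ve-srg is a strongly regular graph whose automorphism group is transitive on vertices and transitive on (undirected) edges. Quotient graph: if $G\le\mathrm{Aut}(\Gamma)$ is vertex-transitive and $1\neq N\triangleleft G$ is intransitive on $V(\Gamma)$, then $\Gamma_N$ is the graph whose vertices are the orbits ${}^Nx=\{h(x): h\in N\}$ of $N$ on $V(\Gamma)$, two distinct orbits ${}^Nx,{}^Ny$ being adjacent if and only if some $x'\in{}^Nx$ and some $y'\in{}^Ny$ are adjacent in $\Gamma$. *)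

(* Defs.v *)
From mathcomp Require Import all_boot all_fingroup.

Set Implicit Arguments.
Unset Strict Implicit.
Unset Printing Implicit Defensive.

Record sgraph := SGraph {
  vert :> finType;
  adj : rel vert;
  adj_sym : symmetric adj;
  adj_irr : irreflexive adj }.

Section Graph.
Variable Gam : sgraph.
Implicit Types (x y : Gam) (G N : {group {perm Gam}}).

Definition complete_graph : Prop := forall x y, x != y -> adj x y.

Definition connected_graph : Prop :=
  0 < #|Gam| /\ forall x y, connect (@adj Gam) x y.

Definition edges : {set {set Gam}} :=
  [set [set p.1; p.2] | p : Gam * Gam & adj p.1 p.2].

Definition neighbours x : {set Gam} := [set y | adj x y].

(* For x <> y the elements z of this set are the middle vertices of the paths
   x - z - y of length 2; when x and y are adjacent they are also the third
   vertices of the triangles on the edge xy. *)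
Definition common_neighbours x y : {set Gam} := neighbours x :&: neighbours y.

(* The clause for complete graphs fixes the parameters that the others leave
   free: mu when there is no non-adjacent pair, and lam when Gam is K_1, where
   the truncated #|Gam| - 2 stands for -1. *)
Definition srg_params (n k lam mu : nat) : Prop :=
  [/\ #|Gam| = n,
      forall x, #|neighbours x| = k,
      forall x y, adj x y -> #|common_neighbours x y| = lam,
      forall x y, x != y -> ~~ adj x y -> #|common_neighbours x y| = mu
    & complete_graph -> lam = n - 2 /\ mu = 0].

Definition strongly_regular : Prop := exists n k lam mu, srg_params n k lam mu.

Definition autset : {set {perm Gam}} :=
  [set s : {perm Gam} | [forall x, forall y, adj (s x) (s y) == adj x y]].

Lemma autset_group : group_set autset.
Proof.
apply/group_setP; split=> [|s t].
  by rewrite inE; apply/forallP=> x; apply/forallP=> y; rewrite !perm1.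
rewrite !inE => /forallP hs /forallP ht.
apply/forallP=> x; apply/forallP=> y; rewrite !permM.
by rewrite (eqP (forallP (ht (s x)) (s y))) (forallP (hs x) y).
Qed.

Definition graph_aut : {group {perm Gam}} := Group autset_group.

Definition vertex_transitive G : bool := [transitive G, on [set: Gam] | 'P].

(* Not [transitive G, on edges | 'P^*], which fails when there are no edges. *)
Definition edge_transitive G : Prop :=
  {in edges &, forall A B, B \in orbit ('P^*)%act G A}.

Definition ve_srg : Prop :=
  [/\ strongly_regular, vertex_transitive graph_aut
    & edge_transitive graph_aut].

Definition vertex_orbits N : {set {set Gam}} :=
  [set orbit 'P%act N x | x : Gam].

Definition quotient_vert N : finType := {A : {set Gam} | A \in vertex_orbits N}.

Definition quotient_adj N : rel (quotient_vert N) :=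
  fun A B => (A != B) && [exists x in val A, exists y in val B, adj x y].

Lemma quotient_adj_sym N : symmetric (@quotient_adj N).
Proof.
move=> A B; rewrite /quotient_adj eq_sym; congr (_ && _).
by apply/exists_inP/exists_inP => -[x xA /exists_inP[y yB xy]];
   exists y => //; apply/exists_inP; exists x => //; rewrite adj_sym.
Qed.

Lemma quotient_adj_irr N : irreflexive (@quotient_adj N).
Proof. by move=> A; rewrite /quotient_adj eqxx. Qed.

Definition quotient_graph N : sgraph :=
  SGraph (@quotient_adj_sym N) (@quotient_adj_irr N).

End Graph.

(* Main.v *)
Require Import Defs.
From mathcomp Require Import all_boot all_fingroup.

Set Implicit Arguments.
Unset Strict Implicit.
Unset Printing Implicit Defensive.

(** Suppose first that [Gam] is complete.  Some element of [N] moves a vertex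
    [z] to another vertex, giving an edge inside an [N]-orbit.  As [N] is normal,
    [G] permutes the [N]-orbits, so edge transitivity of [G] puts every edge, that
    is, every pair of distinct vertices, inside an orbit: [N] is transitive
    ([complete_normal_transitive]).

    In general, connectedness passes to the quotient because a walk projects to a
    walk, possibly with pauses.  Every element of [G] induces an automorphism of
    the quotient ([quotient_aut]) and every edge of the quotient lifts to an edge
    of [Gam], so the quotient inherits both transitivities.  These alone make its
    valency and its parameter lambda constant; only mu requires an argument
    ([quotient_common_neighbours]).

    All orbits have the same size [m], and all pairs of adjacent orbits are joined
    by the same number [e] of edges.  Since [N] is transitive on each orbit, a
    vertex has exactly [d = e / m] neighbours in every orbit adjacent to its own.
    Take distinct non-adjacent orbits [A] and [B] and a vertex [x] of [A], and count
    the paths of length 2 from [x] to vertices of [B].  Each of the [m] ends lies at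
    the end of [mu] paths, as [x] is not adjacent to it.  On the other hand, the
    middle vertex of such a path lies in a common neighbour of [A] and [B], and each
    common neighbour accounts for [d * d] paths.  Hence [A] and [B] have
    [m * mu / (d * d)] common neighbours, whatever [A] and [B] are. *)

(** * Graphs with transitive automorphism groups *)

Section Transitivity.
Variable Gam : sgraph.
Implicit Types (x y : Gam) (G : {group {perm Gam}}).

Lemma vertex_transitiveP G :
  vertex_transitive G <->
  0 < #|Gam| /\ forall x y, exists2 g, g \in G & g x = y.
Proof.
split=> [trG | [/card_gt0P[x0 _] trG]].
  split=> [|x y].
    by case/imsetP: trG => x0 _ _; apply/card_gt0P; exists x0.
  have [g gG ->] := atransP2 trG (in_setT x) (in_setT y).
  by exists g.
apply/imsetP; exists x0; rewrite ?inE //; apply/setP=> y; rewrite inE.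
by apply/esym/orbitP; apply: trG.
Qed.

(** Undirected edge transitivity in terms of end vertices: the element carrying
    one edge to another may exchange the ends. *)
Lemma edge_transitiveP G :
  edge_transitive G <->
  forall x y x' y', adj x y -> adj x' y' ->
    exists2 g, g \in G & (g x = x' /\ g y = y') \/ (g x = y' /\ g y = x').
Proof.
split=> [trG x y x' y' xy xy' |
         trG _ _ /imsetP[[x y] xy ->] /imsetP[[x' y'] xy' ->]].
  have /orbitP[g gG] : [set x'; y'] \in orbit ('P^*)%act G [set x; y].
    by apply: trG; apply/imsetP; [exists (x, y) | exists (x', y')]; rewrite ?inE.
  rewrite /= /setact imsetU1 imset_set1 /aperm => eq_g; exists g => //.
  have: g x \in [set x'; y'] by rewrite -eq_g !inE eqxx.
  have: g y \in [set x'; y'] by rewrite -eq_g !inE eqxx orbT.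
  have neq_g: g x != g y.
    by rewrite (inj_eq perm_inj); apply: contraTneq xy => ->; rewrite adj_irr.
  rewrite !inE => /orP[] /eqP gy /orP[] /eqP gx; move: neq_g;
    by rewrite gx gy ?eqxx //; auto.
rewrite !inE /= in xy xy' *.
have [g gG def_g] := trG _ _ _ _ xy xy'.
apply/orbitP; exists g => //=; rewrite /setact imsetU1 imset_set1 /= !apermE.
by case: def_g => -[-> ->] //; rewrite setUC.
Qed.

Lemma aut_adj (s : {perm Gam}) x y :
  s \in graph_aut Gam -> adj (s x) (s y) = adj x y.
Proof. by rewrite inE => /forallP/(_ x)/forallP/(_ y)/eqP. Qed.

Lemma aut_neighbours (s : {perm Gam}) x :
  s \in graph_aut Gam -> neighbours (s x) = s @: neighbours x.
Proof.
move=> sA; apply/setP=> y; rewrite -{2}(permKV s y) (mem_imset _ _ perm_inj) !inE.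
by rewrite -(aut_adj x _ sA) permKV.
Qed.

Lemma aut_common_neighbours (s : {perm Gam}) x y :
  s \in graph_aut Gam ->
  #|common_neighbours (s x) (s y)| = #|common_neighbours x y|.
Proof.
move=> sA; rewrite /common_neighbours !aut_neighbours // -imsetI.
  by rewrite card_imset //; apply: perm_inj.
by move=> ? ? _ _; apply: perm_inj.
Qed.

End Transitivity.

Lemma constant_value (T : finType) (P : pred T) (f : T -> nat) :
  {in P &, forall p q, f p = f q} -> exists v, {in P, forall p, f p = v}.
Proof.
move=> fP; case: (pickP P) => [p0 Pp0 | P0].
  by exists (f p0) => p Pp; apply: fP.
by exists 0 => p Pp; have := P0 p; rewrite [P p]Pp.
Qed.

(** The transitivity of the automorphism group takes care of the valency and of
    lambda, the number of common neighbours being symmetric in the two ends. *)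
Lemma transitive_strongly_regular (Gam : sgraph) :
    vertex_transitive (graph_aut Gam) -> edge_transitive (graph_aut Gam) ->
    (exists mu, forall x y : Gam,
       x != y -> ~~ adj x y -> #|common_neighbours x y| = mu) ->
  strongly_regular Gam.
Proof.
move=> /vertex_transitiveP[_ trV] /edge_transitiveP trE [mu mu_eq].
have [k k_eq]: exists k, {in predT, forall x : Gam, #|neighbours x| = k}.
  apply: constant_value => x y _ _; have [s sA <-] := trV x y.
  by rewrite aut_neighbours // card_imset //; apply: perm_inj.
case cG: [forall x : Gam, forall y, (x != y) ==> adj x y].
  have {}cG (x y : Gam): x != y -> adj x y.
    by move=> xy; move/forallP/(_ x)/forallP/(_ y)/implyP: cG; apply.
  (* In a complete graph the parameters lambda and mu are prescribed; on K_1,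
     which has no edge, lambda could not be read off from an edge. *)
  exists #|Gam|, k, (#|Gam| - 2), 0; split=> // [x|x y xy|x y xy].
  - exact: k_eq.
  - have neq_xy: x != y by apply: contraTneq xy => ->; rewrite adj_irr.
    have ->: common_neighbours x y = ~: [set x; y].
      apply/setP=> z; rewrite !inE negb_or.
      have adjE u v : @adj Gam u v = (v != u).
        apply/idP/idP; last by rewrite eq_sym; apply: cG.
        by apply: contraTneq => ->; rewrite adj_irr.
      by rewrite !adjE.
    by rewrite -(cardsC [set x; y]) cards2 neq_xy addKn.
  - by rewrite cG.
have [lam lam_eq]: exists lam,
    {in [pred p : Gam * Gam | adj p.1 p.2],
       forall p, #|common_neighbours p.1 p.2| = lam}.
  apply: constant_value => -[x y] [x' y']; rewrite !inE /= => xy xy'.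
  have [s sA def_s] := trE _ _ _ _ xy xy'; rewrite -(aut_common_neighbours _ _ sA).
  by case: def_s => -[-> ->] //; rewrite /common_neighbours setIC.
exists #|Gam|, k, lam, mu; split=> // [x|x y xy|cG']; first exact: k_eq.
  exact: (lam_eq (x, y)).
case/negP: (negbT cG); apply/forallP=> x; apply/forallP=> y.
by apply/implyP; apply: cG'.
Qed.

(** * The graph of orbits *)

Section Orbits.
Variables (Gam : sgraph) (N : {group {perm Gam}}).
Implicit Types (x y z : Gam) (A B C : quotient_graph N) (g : {perm Gam}).

Lemma orbit_of_subproof x : orbit 'P%act N x \in vertex_orbits N.
Proof. exact: imset_f. Qed.

Definition orbit_of x : quotient_graph N :=
  exist _ (orbit 'P%act N x) (orbit_of_subproof x).

Lemma orbit_of_eqP x y :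
  reflect (exists2 h, h \in N & h x = y) (orbit_of x == orbit_of y).
Proof.
by rewrite -val_eqE /= eq_sym orbit_eq_mem; apply: (iffP orbitP).
Qed.

Lemma orbit_of_surj A : exists x, orbit_of x == A.
Proof.
by case/imsetP: (valP A) => x _ def_A; exists x; rewrite -val_eqE def_A.
Qed.

Lemma orbit_ofP A : exists x, A = orbit_of x.
Proof. by have [x /eqP <-] := orbit_of_surj A; exists x. Qed.

Lemma mem_quotient_vert A x : (x \in val A) = (orbit_of x == A).
Proof. by have [y ->] := orbit_ofP A; rewrite -val_eqE /= orbit_eq_mem. Qed.

Lemma quotient_adjP A B :
  reflect (A != B /\ exists x y, [/\ orbit_of x = A, orbit_of y = B & adj x y])
          (adj A B).
Proof.
apply: (iffP andP) => -[neqAB exAB]; split=> //.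
  case/exists_inP: exAB => x xA /exists_inP[y yB xy]; exists x, y.
  by split=> //; apply/eqP; rewrite -mem_quotient_vert.
have [x [y [xA yB xy]]] := exAB.
apply/exists_inP; exists x; first by rewrite mem_quotient_vert xA.
by apply/exists_inP; exists y; rewrite // mem_quotient_vert yB.
Qed.

Lemma quotient_adj_of x y :
  adj x y -> orbit_of x != orbit_of y -> adj (orbit_of x) (orbit_of y).
Proof. by move=> xy neq; apply/quotient_adjP; split=> //; exists x, y. Qed.

Lemma quotient_connected : connected_graph Gam -> connected_graph (quotient_graph N).
Proof.
case=> /card_gt0P[x0 _] con; split; first by apply/card_gt0P; exists (orbit_of x0).
move=> A B; have [x ->] := orbit_ofP A; have [y ->] := orbit_ofP B.
case/connectP: (con x y) => p; elim: p x => [|z p IHp] x /=; first by move=> _ ->.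
case/andP=> xz pz def_y; apply: connect_trans (IHp z pz def_y).
have [-> //|neq] := eqVneq (orbit_of x) (orbit_of z).
by apply: connect1; apply: quotient_adj_of.
Qed.

(** If [h] in [N] takes [x] to [y] then its conjugate by [g], again in [N],
    takes [g x] to [g y]. *)
Lemma norm_orbit_of g x y :
  g \in 'N(N)%g -> (orbit_of (g x) == orbit_of (g y)) = (orbit_of x == orbit_of y).
Proof.
move=> gN; apply/orbit_of_eqP/orbit_of_eqP => -[h hN hE].
  exists (h ^ g^-1)%g; first by rewrite memJ_norm ?groupV.
  by rewrite conjgE invgK !permM hE permK.
exists (h ^ g)%g; first by rewrite memJ_norm.
by rewrite conjgE !permM permK hE.
Qed.

Lemma quotient_aut g :
    g \in graph_aut Gam -> g \in 'N(N)%g ->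
  exists s, [/\ s \in graph_aut (quotient_graph N),
                forall x, s (orbit_of x) = orbit_of (g x)
              & forall A, val (s A) = g @: val A].
Proof.
move=> gA gN.
pose f A := orbit_of (g (xchoose (orbit_of_surj A))).
have fE x : f (orbit_of x) = orbit_of (g x).
  apply/eqP; rewrite /f norm_orbit_of //.
  exact: (xchooseP (orbit_of_surj (orbit_of x))).
have f_inj : injective f.
  move=> A B; have [x ->] := orbit_ofP A; have [y ->] := orbit_ofP B.
  by rewrite !fE => /eqP; rewrite norm_orbit_of // => /eqP.
have valf A : val (f A) = g @: val A.
  have [x ->] := orbit_ofP A; apply/setP=> y.
  rewrite -(permKV g y) (mem_imset _ _ perm_inj) fE !mem_quotient_vert.
  by rewrite norm_orbit_of.
exists (perm f_inj); split=> [|x|A]; rewrite ?permE //.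
rewrite inE; apply/forallP=> A; apply/forallP=> B; rewrite !permE; apply/eqP.
apply/quotient_adjP/quotient_adjP => -[neqAB [x [y [xA yB xy]]]].
  split; first by apply: contraNneq neqAB => ->.
  exists (g^-1 x)%g, (g^-1 y)%g; split; last by rewrite -(aut_adj _ _ gA) !permKV.
    by apply: f_inj; rewrite fE permKV.
  by apply: f_inj; rewrite fE permKV.
split; first by rewrite (inj_eq f_inj).
by exists (g x), (g y); rewrite -!fE xA yB aut_adj.
Qed.

(** * Counting edges between orbits *)

Definition valency_into x A := \sum_(y in val A) (adj x y : nat).

Definition edge_count A B := \sum_(x in val A) valency_into x B.

Lemma edge_countC A B : edge_count A B = edge_count B A.
Proof.
rewrite /edge_count /valency_into exchange_big.
by apply: eq_bigr => x _; apply: eq_bigr => y _; rewrite adj_sym.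
Qed.

Lemma valency_into_aut g A B x :
    g \in graph_aut Gam -> val B = g @: val A ->
  valency_into (g x) B = valency_into x A.
Proof.
move=> gA defB; rewrite /valency_into defB big_imset /=; last exact: in2W perm_inj.
by apply: eq_bigr => y _; rewrite aut_adj.
Qed.

Lemma edge_count_aut g A B A' B' :
    g \in graph_aut Gam -> val A' = g @: val A -> val B' = g @: val B ->
  edge_count A' B' = edge_count A B.
Proof.
move=> gA defA defB; rewrite /edge_count defA big_imset /=; last exact: in2W perm_inj.
by apply: eq_bigr => x _; apply: valency_into_aut.
Qed.

(** Transitivity of [N] on an orbit makes the contributions of its vertices to the
    edge count equal. *)
Lemma edge_countE x B :
    N \subset graph_aut Gam ->
  edge_count (orbit_of x) B = #|val (orbit_of x)| * valency_into x B.
Proof.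
move=> /subsetP NA; rewrite -sum_nat_const; apply: eq_bigr => y.
rewrite mem_quotient_vert eq_sym => /orbit_of_eqP[h hN <-].
apply: valency_into_aut; first exact: NA.
apply/setP=> z; rewrite -(permKV h z) (mem_imset _ _ perm_inj) !mem_quotient_vert.
by congr (_ == _); apply/eqP; rewrite eq_sym; apply/orbit_of_eqP; exists h.
Qed.

Lemma edge_count_gt0 A B : adj A B -> 0 < edge_count A B.
Proof.
case/quotient_adjP=> _ [x [y [xA yB xy]]]; rewrite /edge_count /valency_into.
rewrite (bigD1 x) ?mem_quotient_vert ?xA //= (bigD1 y) ?mem_quotient_vert ?yB //=.
by rewrite xy.
Qed.

Lemma valency_into_gt0 x B :
  N \subset graph_aut Gam -> adj (orbit_of x) B -> 0 < valency_into x B.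
Proof. by move=> NA /edge_count_gt0; rewrite edge_countE // muln_gt0 => /andP[]. Qed.

Lemma valency_into_eq0 x A :
  orbit_of x != A -> ~~ adj (orbit_of x) A -> valency_into x A = 0.
Proof.
move=> neq nadj; apply: big1 => y; rewrite mem_quotient_vert => /eqP def_A.
apply/eqP; rewrite eqb0; apply: contraNN nadj => xy.
by rewrite -def_A quotient_adj_of ?def_A.
Qed.

(** Both sides count the paths of length 2 from [x] to [B], on the right according
    to the orbit [C] of the middle vertex [z]. *)
Lemma sum_common_neighbours x B :
  \sum_(y in val B) #|common_neighbours x y|
    = \sum_(C : quotient_graph N)
        \sum_(z in val C) adj x z * valency_into z B.
Proof.
transitivity (\sum_z adj x z * valency_into z B).
  transitivity (\sum_(y in val B) \sum_z (adj x z * adj z y)).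
    apply: eq_bigr => y _; rewrite -sum1_card big_mkcond.
    by apply: eq_bigr => z _; rewrite !inE (adj_sym y); do 2!case: adj.
  by rewrite exchange_big; apply: eq_bigr => z _; rewrite -big_distrr.
rewrite (partition_big orbit_of predT) //; apply: eq_bigr => C _.
by apply: eq_bigl => z; rewrite mem_quotient_vert.
Qed.

End Orbits.

(** * Quotients by normal subgroups *)

Section NormalQuotient.
Variables (Gam : sgraph) (G N : {group {perm Gam}}).
Hypotheses (sGA : G \subset graph_aut Gam) (nNG : (N <| G)%g).
Hypotheses (trV : vertex_transitive G) (trE : edge_transitive G).
Local Notation Q := (quotient_graph N).

Let sNA : N \subset graph_aut Gam.
Proof. exact: subset_trans (normal_sub nNG) sGA. Qed.

Let lift_aut g : g \in G ->
  exists s, [/\ s \in graph_aut Q,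
                forall x, s (orbit_of N x) = orbit_of N (g x)
              & forall A : Q, val (s A) = g @: val A].
Proof.
move=> gG; apply: quotient_aut; first exact: (subsetP sGA).
exact: (subsetP (normal_norm nNG)).
Qed.

Lemma quotient_vertex_transitive : vertex_transitive (graph_aut Q).
Proof.
have [/card_gt0P[x0 _] trG] := (vertex_transitiveP G).1 trV.
apply/vertex_transitiveP; split; first by apply/card_gt0P; exists (orbit_of N x0).
move=> A B; have [x ->] := orbit_ofP A; have [y ->] := orbit_ofP B.
have [g /lift_aut[s [sA s_orb _]] <-] := trG x y.
by exists s.
Qed.

(** An edge of the quotient is lifted to an edge of [Gam], which is moved there by
    [g]; [s] is the automorphism of the quotient that [g] induces. *)
Lemma quotient_edge_move (A B A' B' : Q) :
    adj A B -> adj A' B' ->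
  exists g s, [/\ g \in G, s \in graph_aut Q,
                  forall C : Q, val (s C) = g @: val C
    & (s A = A' /\ s B = B') \/ (s A = B' /\ s B = A')].
Proof.
move=> /quotient_adjP[_ [x [y [<- <- xy]]]] /quotient_adjP[_ [x' [y' [<- <- xy']]]].
have [g gG def_g] := (edge_transitiveP G).1 trE _ _ _ _ xy xy'.
have [s [sA s_orb s_val]] := lift_aut gG; exists g, s; split=> //.
by rewrite !s_orb; case: def_g => -[-> ->]; auto.
Qed.

Lemma quotient_edge_transitive : edge_transitive (graph_aut Q).
Proof.
apply/edge_transitiveP => A B A' B' AB AB'.
by have [_ [s [_ sA _ def_s]]] := quotient_edge_move AB AB'; exists s.
Qed.

Lemma orbit_card_constant : exists2 m, 0 < m & forall A : Q, #|val A| = m.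
Proof.
have [/card_gt0P[x0 _] trG] := (vertex_transitiveP G).1 trV.
exists #|val (orbit_of N x0)|.
  by apply/card_gt0P; exists x0; rewrite mem_quotient_vert.
move=> A; have [x ->] := orbit_ofP A.
have [g /lift_aut[s [_ s_orb s_val]] <-] := trG x0 x.
by rewrite -s_orb s_val card_imset //; apply: perm_inj.
Qed.

(** The valency of [x] into [B] is the number of edges between the orbit of [x] and
    [B] divided by the size of an orbit; passing through the number of edges makes
    it symmetric in the two orbits, which matters because an element of [G] may
    exchange the ends of an edge.  Positivity is what later allows division by the
    square of the constant. *)
Lemma valency_into_constant :
  exists2 d, 0 < d &
    forall x (B : Q), adj (orbit_of N x) B -> valency_into x B = d.
Proof.
have [m m_gt0 m_eq] := orbit_card_constant.
have [e e_eq]: exists e,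
    {in [pred p : Q * Q | adj p.1 p.2], forall p, edge_count p.1 p.2 = e}.
  apply: constant_value => -[A B] [A' B']; rewrite !inE /= => AB AB'.
  have [g [s [gG _ s_val def_s]]] := quotient_edge_move AB AB'.
  rewrite -(edge_count_aut (subsetP sGA _ gG) (s_val A) (s_val B)).
  by case: def_s => -[-> ->] //; rewrite edge_countC.
(* The quotient may have no edge, and then [e] is arbitrary, possibly 0. *)
exists (maxn 1 (e %/ m)) => [|x B xB]; first by rewrite leq_max.
have := valency_into_gt0 sNA xB.
rewrite -(e_eq (_, _) xB) /= edge_countE // m_eq mulKn //.
by move/maxn_idPr.
Qed.

(** Count in two ways the paths of length 2 from a vertex of [A] to vertices
    of [B]. *)
Lemma quotient_common_neighbours mu :
    (forall x y : Gam, x != y -> ~~ adj x y -> #|common_neighbours x y| = mu) ->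
  exists c, forall A B : Q, A != B -> ~~ adj A B -> #|common_neighbours A B| = c.
Proof.
move=> mu_eq; have [m m_gt0 m_eq] := orbit_card_constant.
have [d d_gt0 d_eq] := valency_into_constant.
exists ((m * mu) %/ (d * d)) => A B neqAB nadjAB; have [x def_A] := orbit_ofP A.
have count : m * mu = #|common_neighbours A B| * (d * d).
  transitivity (\sum_(y in val B) #|common_neighbours x y|).
    rewrite -(m_eq B) -sum_nat_const; apply: eq_bigr => y.
    rewrite mem_quotient_vert => /eqP def_B; rewrite mu_eq //.
      by apply: contraNneq neqAB => def_x; rewrite def_A -def_B def_x.
    apply: contraNN nadjAB => xy.
    by rewrite def_A -def_B quotient_adj_of // def_B -def_A.
  rewrite sum_common_neighbours -sum_nat_const [RHS]big_mkcond.
  apply: eq_bigr => C _; rewrite !inE; case: ifP => [/andP[AC BC] | notAB].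
    rewrite -{1}(d_eq x C) -?def_A // [valency_into x C]/valency_into big_distrl /=.
    apply: eq_bigr => z; rewrite mem_quotient_vert => /eqP def_C.
    by rewrite d_eq // def_C adj_sym.
  (* A path through [C] would make [C] a common neighbour, the cases [C = A] and
     [C = B] being excluded because [A] and [B] are not adjacent. *)
  apply: big1 => z; rewrite mem_quotient_vert => /eqP def_C.
  case xz: (adj x z) => //; rewrite mul1n.
  have [eqAC | neqAC] := eqVneq A C.
    by rewrite valency_into_eq0 // def_C -eqAC.
  have AC: adj A C by rewrite -def_C def_A quotient_adj_of // def_C -def_A.
  have [eqBC | neqBC] := eqVneq B C; first by rewrite eqBC AC in nadjAB.
  rewrite valency_into_eq0 // def_C 1?eq_sym //.
  by rewrite adj_sym; move: notAB; rewrite AC /= => ->.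
by rewrite count mulnK // muln_gt0 d_gt0.
Qed.

End NormalQuotient.

(** An edge inside an [N]-orbit exists because [N] is non-trivial, and [G] carries
    it onto any pair of distinct vertices while preserving the partition into
    orbits. *)
Lemma complete_normal_transitive (Gam : sgraph) (G N : {group {perm Gam}}) :
    vertex_transitive G -> edge_transitive G -> complete_graph Gam ->
    (N <| G)%g -> N :!=: 1%g ->
  vertex_transitive N.
Proof.
move=> /vertex_transitiveP[Gam_gt0 _] /edge_transitiveP trE cG nNG ntN.
apply/vertex_transitiveP; split=> // x y.
have [-> | neq_xy] := eqVneq x y; first by exists 1%g; rewrite ?perm1.
have /trivgPn[h hN nt_h] := ntN.
have [z hz]: exists z, z != h z.
  apply/existsP; apply: contraR nt_h; rewrite negb_exists => /forallP fix_h.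
  apply/eqP/permP=> z; rewrite perm1; apply/esym/eqP.
  by move: (fix_h z); rewrite negbK.
have [g gG def_g] := trE _ _ _ _ (cG _ _ hz) (cG _ _ neq_xy).
apply/orbit_of_eqP; have gN := subsetP (normal_norm nNG) g gG.
have: orbit_of N (g z) == orbit_of N (g (h z)).
  by rewrite norm_orbit_of //; apply/orbit_of_eqP; exists h.
by case: def_g => -[-> ->] //; rewrite eq_sym.
Qed.

Theorem lemma2p4 (Gam : sgraph) (G : {group {perm Gam}})
    (hconn : connected_graph Gam) (hve : ve_srg Gam)
    (hG : G \subset graph_aut Gam)
    (hGv : vertex_transitive G) (hGe : edge_transitive G) :
  (complete_graph Gam ->
     ~ exists N : {group {perm Gam}},
         [/\ (N <| G)%g, N :!=: 1%g & ~~ vertex_transitive N]) /\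
  (~ complete_graph Gam ->
     forall N : {group {perm Gam}},
       (N <| G)%g -> N :!=: 1%g -> ~~ vertex_transitive N ->
       connected_graph (quotient_graph N) /\ ve_srg (quotient_graph N)).
Proof.
split=> [cG [N [nNG ntN /negP[]]] | _ N nNG _ _].
  exact: complete_normal_transitive nNG ntN.
split; first exact: quotient_connected.
have trQV := quotient_vertex_transitive hG nNG hGv.
have trQE := quotient_edge_transitive hG nNG hGe.
split=> //; apply: transitive_strongly_regular => //.
have [[n [k [lam [mu [_ _ _ mu_eq _]]]]] _ _] := hve.
exact (quotient_common_neighbours hG nNG hGv hGe mu_eq).
Qed.
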